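(* Let $p$ be a prime, let $d \ge 2$, let $F$ be the free pro-$p$ group on $d$ generators, let $F' = \overline{[F,F]}$, and let $G$ be the quotient of $F$ by the closed subgroup $\overline{[[F',F'],F']}$ (the third term of the lower central series of $F'$, when $F'$ itself is counted as the first). Then $G$ has normal subgroup growth of type $n^{\log n}$.
   Context: A function $f(n)$ is of type $g(n)$ if there are constants $c_1, c_2 > 0$ such that $\log f(n) \le c_1 \log g(n)$ for all $n$, and $\log f(n) > c_2 \log g(n)$ for infinitely many $n$. A profinite group $G$ has normal subgroup growth of type $g(n)$ if the number of open normal subgroups of $G$ of index at most $n$ is a function of $n$ of type $g(n)$. *)

(* Defs.v *)
From HB Require Import structures.
From mathcomp Require Import all_boot all_order all_algebra.
From mathcomp Require Import all_classical all_reals all_analysis.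

Set Implicit Arguments.
Unset Strict Implicit.
Unset Printing Implicit Defensive.

Local Open Scope classical_set_scope.
Local Open Scope card_scope.
Local Open Scope group_scope.

HB.mixin Record isTopologicalGroup G & Group G & Topological G := {
  mulg_continuous : continuous (fun xy : G * G => xy.1 * xy.2);
  invg_continuous : continuous (fun x : G => x^-1)
}.

#[short(type="topologicalGroupType")]
HB.structure Definition TopologicalGroup :=
  {G of Group G & Topological G & isTopologicalGroup G}.

Section Subgroups.
Variable G : groupType.
Implicit Types A B N : set G.

Definition is_subgroup N :=
  N 1 /\ forall x y, N x -> N y -> N (x * y^-1).

Definition is_normal_subgroup N :=
  is_subgroup N /\ forall x y, N x -> N (x ^ y).

(* The abstract (not topologically closed) subgroup generated by A. *)
Definition gen A : set G := smallest is_subgroup A.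

Definition comm_sub A B : set G :=
  gen [set z | exists x y, [/\ A x, B y & z = [~ x, y]]].

Definition lcosets N : set (set G) :=
  [set [set x * y | y in N] | x in [set: G]].

Lemma subgroup_inv N x : is_subgroup N -> N x -> N x^-1.
Proof. by move=> [N1 ND] Nx; rewrite -[_^-1]mul1g; exact: ND. Qed.

Lemma subgroup_mul N x y : is_subgroup N -> N x -> N y -> N (x * y).
Proof.
move=> sN Nx Ny; rewrite -[y]invgK; apply: sN.2 => //.
exact: subgroup_inv.
Qed.

Lemma gen_subgroup A : is_subgroup (gen A).
Proof.
split=> [B [[B1 _] _] //|x y gx gy B [sB AB]].
by apply: sB.2; [exact: gx | exact: gy].
Qed.

Lemma gen_normal A : (forall x y, A x -> A (x ^ y)) ->
  is_normal_subgroup (gen A).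
Proof.
move=> AJ; split; first exact: gen_subgroup.
move=> x y gx.
have : [set z | gen A (z ^ y)] x; last by [].
apply: gx; split; last first.
  by move=> z Az /=; apply: sub_gen_smallest; exact: AJ.
have [g1 gD] := gen_subgroup A; split=> /= [|u v gu gv].
  by rewrite conj1g.
by rewrite conjMg conjVg; exact: gD.
Qed.

Lemma comm_sub_normal A B : is_normal_subgroup A -> is_normal_subgroup B ->
  is_normal_subgroup (comm_sub A B).
Proof.
move=> [_ AJ] [_ BJ]; apply: gen_normal => _ z [x [y [Ax By ->]]].
by exists (x ^ z), (y ^ z); rewrite conjRg; split; [exact: AJ | exact: BJ |].
Qed.

Lemma setT_normal : is_normal_subgroup [set: G].
Proof. by []. Qed.

End Subgroups.

Section Closure.
Variable G : topologicalGroupType.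
Implicit Types N : set G.

Lemma conjg_continuous (y : G) : continuous (fun x : G => x ^ y).
Proof.
move=> x; rewrite /conjg.
apply: (@continuous_comp _ _ _ (fun x : G => (y^-1, x * y))
  (fun xy : G * G => xy.1 * xy.2)); last exact: mulg_continuous.
apply: cvg_pair; first exact: cvg_cst.
apply: (@continuous_comp _ _ _ (fun x : G => (x, y))
  (fun xy : G * G => xy.1 * xy.2)); last exact: mulg_continuous.
by apply: cvg_pair; [exact: cvg_id | exact: cvg_cst].
Qed.

Lemma divg_continuous : continuous (fun xy : G * G => xy.1 * xy.2^-1).
Proof.
move=> xy.
apply: (@continuous_comp _ _ _ (fun xy : G * G => (xy.1, xy.2^-1))
  (fun xy : G * G => xy.1 * xy.2)); last exact: mulg_continuous.
apply: cvg_pair; first exact: cvg_fst.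
by apply: (@cvg_comp _ _ _ snd (fun x : G => x^-1));
  [exact: cvg_snd | exact: invg_continuous].
Qed.

Lemma closure_normal N : is_normal_subgroup N -> is_normal_subgroup (closure N).
Proof.
move=> [[N1 ND] NJ]; split; first split.
- exact: subset_closure.
- move=> x y cx cy U Uxy.
  have [[V W] /= [nV nW] VWU] := @divg_continuous (x, y) U Uxy.
  have [u [Nu Vu]] := cx _ nV; have [v [Nv Wv]] := cy _ nW.
  by exists (u * v^-1); split; [exact: ND | exact: (VWU (u, v))].
- move=> x y cx U Uxy.
  have [u [Nu Uu]] := cx _ (@conjg_continuous y x U Uxy).
  by exists (u ^ y); split; [exact: NJ|].
Qed.

End Closure.

Record normal_subgroup (G : groupType) := NormalSubgroup {
  normal_set :> set G;
  normal_setP : is_normal_subgroup normal_set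
}.

(* The topological group G / N. *)
Section Quotient.
Variables (G : topologicalGroupType) (N : normal_subgroup G).
Local Open Scope quotient_scope.

Let K := normal_set N.
Let N1 : K 1. Proof. exact: (normal_setP N).1.1. Qed.
Let NV x : K x -> K x^-1. Proof. exact: subgroup_inv (normal_setP N).1. Qed.
Let NM x y : K x -> K y -> K (x * y).
Proof. exact: subgroup_mul (normal_setP N).1. Qed.
Let NJ x y : K x -> K (x ^ y). Proof. exact: (normal_setP N).2. Qed.

Definition quot_rel : rel G := fun x y => `[< normal_set N (x^-1 * y) >].

Lemma quot_rel_equiv : equiv_class_of quot_rel.
Proof.
split=> [x|x y|y x z].
- by apply/asboolP; rewrite mulVg.
- by apply: asbool_equiv_eq; split=> /NV; rewrite invgM invgK.
- move=> /asboolP xy /asboolP yz; apply/asboolP.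
  by move: (NM xy yz); rewrite mulgA mulgK.
Qed.

Canonical quot_equiv := EquivRelPack quot_rel_equiv.

Definition quot_top : Type := quotient_topology {eq_quot quot_equiv}.
HB.instance Definition _ := Topological.on quot_top.
HB.instance Definition _ := Quotient.on quot_top.

Definition quot_pi (x : G) : quot_top := \pi_quot_top x.

Lemma quot_piP x y : quot_pi x = quot_pi y <-> normal_set N (x^-1 * y).
Proof. by split=> [/eqmodP/asboolP //|h]; exact/eqmodP/asboolP. Qed.

Lemma quot_reprK (a : quot_top) : quot_pi (repr a) = a.
Proof. exact: reprK. Qed.

Definition quot_mul (a b : quot_top) : quot_top := quot_pi (repr a * repr b).
Definition quot_inv (a : quot_top) : quot_top := quot_pi (repr a)^-1.
Definition quot_one : quot_top := quot_pi 1.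

Lemma quot_mul_pi x y : quot_mul (quot_pi x) (quot_pi y) = quot_pi (x * y).
Proof.
apply/quot_piP; set u := repr _; set v := repr _.
have hu : K (u^-1 * x) by apply/quot_piP; exact: quot_reprK.
have hv : K (v^-1 * y) by apply/quot_piP; exact: quot_reprK.
have -> : (u * v)^-1 * (x * y) = (u^-1 * x) ^ v * (v^-1 * y).
  by rewrite /conjg invgM !mulgA !mulgK.
by apply: NM => //; exact: NJ.
Qed.

Lemma quot_inv_pi x : quot_inv (quot_pi x) = quot_pi x^-1.
Proof.
apply/quot_piP; set u := repr _.
have hu : K (u^-1 * x) by apply/quot_piP; exact: quot_reprK.
have -> : u^-1^-1 * x^-1 = ((u^-1 * x)^-1) ^ u^-1.
  by rewrite /conjg invgM !invgK !mulgA mulgK.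
by apply: NJ; exact: NV.
Qed.

Lemma quot_mulA : associative quot_mul.
Proof.
move=> a b c; rewrite -(quot_reprK a) -(quot_reprK b) -(quot_reprK c).
by rewrite !quot_mul_pi mulgA.
Qed.

Lemma quot_mul1 : left_id quot_one quot_mul.
Proof. by move=> a; rewrite -(quot_reprK a) quot_mul_pi mul1g. Qed.

Lemma quot_mul1r : right_id quot_one quot_mul.
Proof. by move=> a; rewrite -(quot_reprK a) quot_mul_pi mulg1. Qed.

Lemma quot_mulV : left_inverse quot_one quot_inv quot_mul.
Proof.
by move=> a; rewrite -(quot_reprK a) quot_inv_pi quot_mul_pi mulVg.
Qed.

Lemma quot_mulVr : right_inverse quot_one quot_inv quot_mul.
Proof.
by move=> a; rewrite -(quot_reprK a) quot_inv_pi quot_mul_pi mulgV.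
Qed.

HB.instance Definition _ := isGroup.Build quot_top
  quot_mulA quot_mul1 quot_mul1r quot_mulV quot_mulVr.

Lemma quot_pi_continuous : continuous quot_pi.
Proof. exact: pi_continuous. Qed.

Lemma quot_pi_open (U : set G) : open U -> open (quot_pi @` U).
Proof.
move=> oU.
change (open (quot_pi @^-1` (quot_pi @` U))).
have -> : quot_pi @^-1` (quot_pi @` U) =
    \bigcup_(k in K) ((fun x => x * k) @^-1` U).
  apply/seteqP; split=> [x [u Uu /esym/quot_piP xu]|x [k Kk /= Uxk]].
    by exists (x^-1 * u) => //=; rewrite mulVKg.
  by exists (x * k) => //; apply/esym/quot_piP; rewrite mulKg.
apply: bigcup_open => k _; apply: open_comp => // x _.
apply: (@continuous_comp _ _ _ (fun x : G => (x, k))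
  (fun xy : G * G => xy.1 * xy.2)); last exact: mulg_continuous.
by apply: cvg_pair; [exact: cvg_id | exact: cvg_cst].
Qed.

Lemma quot_pi_nbhs (U : set G) x : nbhs x U -> nbhs (quot_pi x) (quot_pi @` U).
Proof.
rewrite nbhsE => -[V [oV Vx] VU]; apply: (@filterS _ _ _ (quot_pi @` V)).
  exact: image_subset.
by apply: open_nbhs_nbhs; split; [exact: quot_pi_open | exists x].
Qed.

Lemma quot_mul_continuous :
  continuous (fun ab : quot_top * quot_top => ab.1 * ab.2).
Proof.
move=> [a b]; rewrite -(quot_reprK a) -(quot_reprK b).
move: (repr a) (repr b) => x y W /=.
rewrite -[_ * _]/(quot_mul _ _) quot_mul_pi => /quot_pi_continuous WW.
have [[U V] /= [nU nV] UVW] := @mulg_continuous G (x, y) _ WW.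
exists (quot_pi @` U, quot_pi @` V); first by split; exact: quot_pi_nbhs.
move=> [_ _] [/= [u Uu <-] [v Vv <-]] /=.
rewrite -[_ * _]/(quot_mul _ _) quot_mul_pi.
exact: (UVW (u, v)).
Qed.

Lemma quot_inv_continuous : continuous (fun a : quot_top => a^-1).
Proof.
move=> a; rewrite -(quot_reprK a); move: (repr a) => x W /=.
rewrite -[_^-1]/(quot_inv _) quot_inv_pi => /quot_pi_continuous WW.
have := quot_pi_nbhs (@invg_continuous G x _ WW); apply: filterS.
move=> _ [u Uu <-] /=; rewrite -[_^-1]/(quot_inv _) quot_inv_pi.
exact: Uu.
Qed.

HB.instance Definition _ := isTopologicalGroup.Build quot_top
  quot_mul_continuous quot_inv_continuous.

End Quotient.

Definition quotient_group (G : topologicalGroupType) (N : normal_subgroup G) :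
  topologicalGroupType := quot_top N.

Definition pro_p (p : nat) (G : topologicalGroupType) :=
  [/\ compact [set: G], hausdorff_space G, totally_disconnected [set: G] &
    forall N : set G, is_normal_subgroup N -> open N ->
      exists k : nat, lcosets N #= `I_(p ^ k)%N].

Definition free_pro_p (p : nat) (F : topologicalGroupType) (d : nat)
    (x : 'I_d -> F) :=
  pro_p p F /\
  forall (H : topologicalGroupType) (y : 'I_d -> H), pro_p p H ->
    exists! f : F -> H, [/\ continuous f, {morph f : a b / a * b >-> a * b} &
      forall i, f (x i) = y i].

Definition derived (F : topologicalGroupType) : set F :=
  closure (comm_sub [set: F] [set: F]).
Arguments derived : clear implicits.

(* The third term of the lower central series of F', F' being the first. *)
Definition derived_lower3_set (F : topologicalGroupType) : set F :=
  closure (comm_sub (comm_sub (derived F) (derived F)) (derived F)).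
Arguments derived_lower3_set : clear implicits.

Lemma derived_lower3_normal (F : topologicalGroupType) :
  is_normal_subgroup (derived_lower3_set F).
Proof.
have nF' : is_normal_subgroup (derived F).
  by apply: closure_normal; apply: comm_sub_normal; exact: setT_normal.
apply: closure_normal; apply: comm_sub_normal => //.
exact: comm_sub_normal.
Qed.

Definition derived_lower3 (F : topologicalGroupType) : normal_subgroup F :=
  NormalSubgroup (@derived_lower3_normal F).

Definition open_normal_subgroups (G : topologicalGroupType) (n : nat) :
    set (set G) :=
  [set N | [/\ is_normal_subgroup N, open N & lcosets N #<= `I_n]].
Arguments open_normal_subgroups : clear implicits.

(* `n = 0` is excluded from the upper bound: logarithms of growth functions are
   only meaningful at positive integers. *)
Definition of_type (R : realType) (f g : nat -> R) :=
  exists c1 c2 : R, [/\ (0 < c1)%R, (0 < c2)%R,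
    forall n, (0 < n)%N -> (ln (f n) <= c1 * ln (g n))%R &
    forall m, exists n, (m <= n)%N /\ (c2 * ln (g n) < ln (f n))%R].

(* The counting function must be finite-valued: `f n` is the number of open
   normal subgroups of index at most `n`. *)
Definition normal_subgroup_growth (R : realType) (G : topologicalGroupType)
    (g : nat -> R) :=
  exists f : nat -> nat,
    (forall n, open_normal_subgroups G n #= `I_(f n)) /\
    of_type (fun n => (f n)%:R%R) g.

(* Main.v *)
Require Import Defs.
From HB Require Import structures.
From mathcomp Require Import zify ring.
From mathcomp Require Import all_boot all_order all_algebra.
From mathcomp Require Import all_fingroup all_solvable.
From mathcomp Require Import all_classical all_reals all_analysis.
(* Imported again because fingroup also exports a constant named lcosets. *)
Import Defs.

Set Implicit Arguments.
Unset Strict Implicit.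
Unset Printing Implicit Defensive.

(* Upper bound, valid for all of F. Let M be an open normal subgroup of index
   p^(k+1). Since F/M is a p-group, M lies in an open normal N of index p^k with
   N/M central in F/M. If s_1, ..., s_r are normal generators of N and s_j is
   not in M, then s_i = s_j^(a_i) modulo M with 0 <= a_i < p, and M is normally
   generated by the s_i s_j^(-a_i), s_j^p and the [s_j, x_l]. So r grows by d+1
   at each step, and M is determined by k choices of pairs (j, a), the one at
   level i ranging over a set of size at most p^(O(i)): there are at most
   p^(O(k^2)) subgroups M.

   Lower bound. Let A be cyclic of order q, a power of p, acting by translation
   on V = F_p^A. The cross-correlation V x V -> F_p^K, restricted to a set K of
   shifts with K and -K disjoint, is A-invariant, hence defines an extension of V
   by the central subgroup Z = F_p^K, on which A acts. The semidirect product H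
   satisfies [H',H'] <= Z, so homomorphisms F -> H kill the third term of the
   lower central series of F'. One of them maps x_0 to a generator of A and x_1
   to the indicator of 0; its image contains Z because the commutators of the
   translates of that indicator are the basis vectors of Z. All subgroups of Z
   are normal in H; with |K| proportional to q there are p^(c q^2) of them, while
   |H| = p^(O(q)). *)

Import Order.TTheory GRing.Theory Num.Theory.
Local Open Scope classical_set_scope.
Local Open Scope card_scope.
Local Open Scope group_scope.

(** * Finite quotients *)

Lemma card_le_inj_on (T U : Type) (A : set T) (B : set U) (f : T -> U) :
  (forall a, A a -> B (f a)) ->
  (forall a b, A a -> A b -> f a = f b -> a = b) -> A #<= B.
Proof.
move=> AB fI; have fA : {in A &, injective f}.
  by move=> a b /set_mem Aa /set_mem Ab; exact: fI.
rewrite -(card_le_eql (inj_card_eq fA)); apply: subset_card_le.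
by move=> _ [a Aa <-]; exact: AB.
Qed.

Lemma card_finset (T : finType) (A : {set T}) : [set` A] #= `I_#|A|.
Proof.
apply: card_esym; rewrite (card_eql card_II).
have inj : {in [set: 'I_#|A|] &, injective (@enum_val T (mem A))}.
  by move=> i j _ _; exact: enum_val_inj.
rewrite -(card_eql (inj_card_eq inj)).
rewrite (_ : _ @` _ = [set` A]) ?card_eqxx//.
apply/seteqP; split=> [_ [i _ <-]|x /= xA]; first exact: enum_valP.
by exists (enum_rank_in xA x); rewrite // enum_rankK_in.
Qed.

Section Morphisms.
Variables (E E' : groupType) (f : E -> E').
Hypothesis fM : {morph f : a b / a * b}.

Lemma morph_one : f 1 = 1.
Proof. by apply: (mulgI (f 1)); rewrite -fM !mulg1. Qed.

Lemma morph_inv a : f a^-1 = (f a)^-1.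
Proof. by apply: (mulgI (f a)); rewrite -fM !mulgV morph_one. Qed.

Lemma morph_exp a n : f (a ^+ n) = f a ^+ n.
Proof.
elim: n => [|n IHn]; first by rewrite !expg0 morph_one.
by rewrite !expgS fM IHn.
Qed.

Lemma morph_comm a b : f [~ a, b] = [~ f a, f b].
Proof. by rewrite /commg /conjg !fM !morph_inv. Qed.

Lemma preim_subgroup (W : set E') :
  is_subgroup W -> is_subgroup (f @^-1` W).
Proof.
move=> [W1 WD]; split=> [|a b] /=; first by rewrite morph_one.
by rewrite fM morph_inv; exact: WD.
Qed.

Lemma preim_normal (W : set E') :
  is_normal_subgroup W -> is_normal_subgroup (f @^-1` W).
Proof.
move=> [sW WJ]; split; first exact: preim_subgroup.
by move=> a b /=; rewrite /conjg !fM morph_inv => /(WJ _ (f b)).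
Qed.

End Morphisms.

Lemma lcoset_setE (E : groupType) (N : set E) x :
  is_subgroup N -> [set x * y | y in N] = [set y | N (x^-1 * y)].
Proof.
move=> sN; apply/seteqP; split=> [_ [y Ny <-]|y Ny] /=; first by rewrite mulKg.
by exists (x^-1 * y) => //; rewrite mulVKg.
Qed.

Lemma group_set_subgroup (gT : finGroupType) (W : {group gT}) :
  is_subgroup [set` W].
Proof. by split=> [|a b] /=; [exact: group1 | move=> *; rewrite groupM ?groupV]. Qed.

Lemma group_set_normal (gT : finGroupType) (W : {group gT}) :
  [set: gT]%SET \subset 'N(W) -> is_normal_subgroup [set` W].
Proof.
move=> nW; split=> [|a b /= aW]; first exact: group_set_subgroup.
by rewrite memJ_norm // (fintype.subsetP nW) ?inE.
Qed.

Lemma subgroup_finset (gT : finGroupType) (N : set gT) :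
  is_subgroup N -> exists W : {group gT}, N = [set` W].
Proof.
move=> sN; have gN : group_set [set x : gT | `[< N x >]]%SET.
  apply/group_setP; split=> [|a b]; rewrite !inE.
    exact: sN.1.
  exact: subgroup_mul.
by exists (Group gN); apply/seteqP; split=> a /=; rewrite !inE.
Qed.

(** As [f] is onto, taking preimages is injective on subsets of [gT] and carries the left cosets of
    [W] to those of its preimage. *)
Lemma lcosets_preim (E : groupType) (gT : finGroupType) (f : E -> gT)
    (W : {group gT}) : {morph f : a b / a * b} -> set_surj setT setT f ->
  lcosets (f @^-1` [set` W]) #= `I_#|[set: gT]%SET : W|.
Proof.
move=> fM fS; pose g (A : {set gT}) := f @^-1` [set` A].
have gI : {in [set` fingroup.lcosets W [set: gT]%SET] &, injective g}.
  move=> A B _ _ /seteqP[AB BA]; apply/setP=> y.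
  by have [x _ <-] := fS y I; apply/idP/idP; [exact: AB | exact: BA].
rewrite -card_lcosets -(card_eqr (card_finset _)) -(card_eqr (inj_card_eq gI)).
suff -> : lcosets (f @^-1` [set` W]) =
    g @` [set` fingroup.lcosets W [set: gT]%SET] by exact: card_eqxx.
have gE x : [set x * y | y in f @^-1` [set` W]] = g (f x *: W).
  rewrite lcoset_setE; last first.
    by apply: preim_subgroup => //; exact: group_set_subgroup.
  by apply/seteqP; rewrite /g; split=> y /=; rewrite mem_lcoset fM morph_inv.
apply/seteqP; split=> [_ [x _ <-]|_ [_ /lcosetsP[y _ ->] <-]].
  by exists (f x *: W) => //=; apply/lcosetsP; exists (f x); rewrite ?inE.
by have [x _ <-] := fS y I; exists x.
Qed.

(** The group law of E/L is transported to ['I_n] along a numbering of the cosets, so that finite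
    group theory applies to the quotient. *)
Lemma finite_quotient (E : groupType) (L : set E) n :
  is_normal_subgroup L -> lcosets L #= `I_n ->
  exists (gT : finGroupType) (f : E -> gT),
    [/\ {morph f : a b / a * b}, set_surj setT setT f,
        forall a, f a = 1 <-> L a & #|gT| = n].
Proof.
move=> nL /card_set_bijP[e [eF eI eS]].
have sL := nL.1.
have cosetE x y : [set x * z | z in L] = [set y * z | z in L] <-> L (x^-1 * y).
  rewrite !lcoset_setE //; split=> [/seteqP[_ yx]|xy].
    by apply: yx; rewrite /= mulVg; exact: sL.1.
  apply/seteqP; split=> z /= h.
    by rewrite -[z](mulKVg x) mulgA -[y^-1 * x]invgK invgM invgK;
       apply: subgroup_mul => //; exact: subgroup_inv.
  by rewrite -[z](mulKVg y) mulgA; exact: subgroup_mul.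
pose c x := [set x * z | z in L].
have ltc x : (e (c x) < n)%N by apply: eF; exists x.
pose f x : 'I_n := Ordinal (ltc x).
have fE x y : f x = f y <-> L (x^-1 * y).
  rewrite -cosetE; split=> [[exy]|xy]; last by apply/val_inj => /=; rewrite /c xy.
  by apply: eI => //; rewrite inE; [exists x | exists y].
have fS i : exists x, f x = i.
  have [_ [x _ <-] ex] := eS i (ltn_ord i).
  by exists x; apply/val_inj.
have [r rK] := choice fS.
have rP x : L ((r (f x))^-1 * x) by apply/fE; rewrite rK.
have fM x y : f (r (f x) * r (f y)) = f (x * y).
  apply/fE; have -> : (r (f x) * r (f y))^-1 * (x * y) =
     ((r (f x))^-1 * x) ^ (r (f y)) * ((r (f y))^-1 * y).
    by rewrite /conjg invgM !mulgA !mulgK.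
  by apply: subgroup_mul => //; exact: nL.2.
have fV x : f (r (f x))^-1 = f x^-1.
  apply/fE; rewrite invgK.
  have -> : r (f x) * x^-1 = (((r (f x))^-1 * x)^-1) ^ (r (f x))^-1.
    by rewrite /conjg invgM !invgK !mulgA mulgK.
  by apply: nL.2; exact: subgroup_inv.
pose mul i j := f (r i * r j).
have mulE x y : mul (f x) (f y) = f (x * y) by exact: fM.
have mA : associative mul.
  by move=> i j k; rewrite -(rK i) -(rK j) -(rK k) !mulE mulgA.
have m1 : left_id (f 1) mul by move=> i; rewrite -(rK i) mulE mul1g.
have mV : left_inverse (f 1) (fun i => f (r i)^-1) mul.
  by move=> i; rewrite -(rK i) fV mulE mulVg.
pose gT : finGroupType := HB.pack 'I_n (Finite_isGroup.Build 'I_n mA m1 mV).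
exists gT, f; split.
- by move=> x y; rewrite -[RHS]/(mul (f x) (f y)) mulE.
- by move=> i _; have [x <-] := fS i; exists x.
- by move=> a; rewrite -[1]/(f 1); split=> [/esym/fE|La];
    [|apply/esym/fE]; rewrite invg1 mul1g.
- exact: card_ord.
Qed.

(** * Discrete p-groups and topological generation *)

(** An alias carrying the discrete topology, so that finite p-groups can be targets in the universal
    property of [F]. *)
Definition discrete_group (gT : finGroupType) : Type := discrete_topology gT.

HB.instance Definition _ (gT : finGroupType) :=
  DiscreteTopology.on (discrete_group gT).
HB.instance Definition _ (gT : finGroupType) :=
  Group.copy (discrete_group gT) gT.

Section DiscreteGroup.
Variable gT : finGroupType.

Lemma discrete_group_open (U : set (discrete_group gT)) : open U.
Proof. exact: discrete_open. Qed.

Lemma discrete_mulg_continuous :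
  continuous (fun xy : discrete_group gT * discrete_group gT => xy.1 * xy.2).
Proof.
move=> [a b] U /nbhs_singleton /= Uab; exists ([set a], [set b]).
  by split; apply: open_nbhs_nbhs; split=> //; exact: discrete_group_open.
by move=> [_ _] [/= -> ->].
Qed.

Lemma discrete_invg_continuous : continuous (fun x : discrete_group gT => x^-1).
Proof.
move=> a U /nbhs_singleton Ua.
by apply: open_nbhs_nbhs; split=> //; exact: discrete_group_open.
Qed.

HB.instance Definition _ := isTopologicalGroup.Build (discrete_group gT)
  discrete_mulg_continuous discrete_invg_continuous.

Lemma pro_p_discrete (p : nat) :
  p.-group [set: gT]%SET -> pro_p p (discrete_group gT).
Proof.
move=> pG; split.
- by apply: finite_compact; exact: (@finite_finset gT).
- exact: discrete_hausdorff.
- by apply: zero_dimension_totally_disconnected; exact: discrete_zero_dimension.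
- move=> N [sN _] _; have [W ->] := @subgroup_finset gT N sN.
  have /p_natP[k idx] : p.-nat #|[set: gT]%SET : W|.
    by apply: pnat_dvd pG; exact: dvdn_indexg.
  exists k; rewrite -idx; apply: (@lcosets_preim (discrete_group gT) gT id) => //.
Qed.

(** Every preimage is a union of translates of the kernel. *)
Lemma open_kernel_continuous (E : topologicalGroupType)
    (f : E -> discrete_group gT) : {morph f : a b / a * b} ->
  open (f @^-1` [set 1]) -> continuous f.
Proof.
move=> fM oK; apply/continuousP => U _.
rewrite (_ : f @^-1` U = \bigcup_(a in f @^-1` U)
    ((fun x => a^-1 * x) @^-1` (f @^-1` [set 1]))); last first.
  apply/seteqP; split=> [a Ua|x [a /= Ua]].
    by exists a; rewrite //= mulVg morph_one.
  by rewrite fM morph_inv // => /eqP; rewrite -eq_mulVg1 => /eqP <-.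
apply: bigcup_open => a _; apply: open_comp => // x _.
apply: (@continuous_comp _ _ _ (fun x : E => (a^-1, x))
  (fun xy : E * E => xy.1 * xy.2)); last exact: mulg_continuous.
by apply: cvg_pair; [exact: cvg_cst | exact: cvg_id].
Qed.

End DiscreteGroup.

Section FreeProP.
Variables (p d : nat) (F : topologicalGroupType) (x : 'I_d -> F).
Hypothesis freeF : free_pro_p p x.

(** If the images of the [x i] lay in a maximal subgroup M, which is normal in a p-group, then the
    map from F onto gT/M and the trivial map would agree on the [x i]. Uniqueness in the universal
    property would make them equal, although M is proper. *)
Lemma free_pro_p_quotient_gen (gT : finGroupType) (f : F -> gT) :
  p.-group [set: gT]%SET -> {morph f : a b / a * b} ->
  set_surj setT setT f -> open (f @^-1` [set 1]) ->
  <<[set f (x i) | i : 'I_d]%SET>> = [set: gT]%SET.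
Proof.
move=> pG fM fS oK.
have [//|[M maxM sM]] :=
  maximal_exists (finset.subsetT <<[set f (x i) | i : 'I_d]%SET>>).
have nM : [set: gT]%SET \subset 'N(M) := normal_norm (p_maximal_normal pG maxM).
have [|gT' [h [hM hS hK cardh]]] := finite_quotient (L := f @^-1` [set` M])
  _ (lcosets_preim M fM fS).
  by apply: preim_normal => //; exact: group_set_normal.
have pgT' : p.-group [set: gT']%SET.
  rewrite /pgroup cardsT cardh; apply: pnat_dvd pG; exact: dvdn_indexg.
have oM : open (f @^-1` [set` M]).
  have /continuousP := open_kernel_continuous (gT := gT) fM oK.
  by apply; exact: discrete_group_open.
have [_ /(_ (discrete_group gT') (fun=> 1) (pro_p_discrete pgT'))] := freeF.
move=> [u [_ uU]].
have h1 : u = h.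
  apply: uU; split=> //.
    apply: open_kernel_continuous => //.
    by rewrite (_ : _ @^-1` _ = f @^-1` [set` M]) //; apply/seteqP; split=> a /hK.
  by move=> i; apply/hK/(fintype.subsetP sM)/mem_gen/imset_f.
have u1 : u = fun=> 1.
  apply: uU; split=> //; first by move=> a; exact: cvg_cst.
  by move=> a b /=; rewrite mulg1.
have := maxgroupp maxM; rewrite finset.properEneq => /andP[/eqP]; case.
apply/setP=> y; rewrite inE; have [a _ <-] := fS y I.
by apply/hK; rewrite -h1 u1.
Qed.

End FreeProP.

(** * Normal generators *)

Section Enumeration.
Variables (p d : nat) (F : topologicalGroupType) (x : 'I_d -> F).
Hypotheses (pr_p : prime p) (freeF : free_pro_p p x).

Definition open_normal (N : set F) := is_normal_subgroup N /\ open N.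

Lemma open_preim (gT : finGroupType) (f : F -> gT) (U : set gT) :
  {morph f : a b / a * b} -> open (f @^-1` [set 1]) -> open (f @^-1` U).
Proof.
move=> fM oK; have /continuousP := open_kernel_continuous (gT := gT) fM oK.
by apply; exact: discrete_group_open.
Qed.

Lemma open_normal_preim (gT : finGroupType) (f : F -> gT) (W : {group gT}) :
  {morph f : a b / a * b} -> open (f @^-1` [set 1]) ->
  [set: gT]%SET \subset 'N(W) -> open_normal (f @^-1` [set` W]).
Proof.
move=> fM oK nW; split; last exact: open_preim.
by apply: preim_normal => //; exact: group_set_normal.
Qed.

Lemma open_normalI (M N : set F) :
  open_normal M -> open_normal N -> open_normal (M `&` N).
Proof.
move=> [[[M1 MD] MJ] oM] [[[N1 ND] NJ] oN]; split; last exact: openI.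
split; first split=> //.
- by move=> a b [Ma Na] [Mb Nb]; split; [exact: MD | exact: ND].
- by move=> a b [Ma Na]; split; [exact: MJ | exact: NJ].
Qed.

Lemma open_normal_quotient (L : set F) n : open_normal L ->
  lcosets L #= `I_n ->
  exists (gT : finGroupType) (f : F -> gT),
    [/\ {morph f : a b / a * b}, set_surj setT setT f,
        L = f @^-1` [set 1], #|gT| = n & p.-group [set: gT]%SET].
Proof.
move=> [nL oL] Ln; have [gT [f [fM fS fK cT]]] := finite_quotient nL Ln.
exists gT, f; split=> //; first by apply/seteqP; split=> a /fK.
have [_ _ _ /(_ _ nL oL)[k Lk]] := freeF.1.
rewrite /pgroup cardsT cT; have /card_eq_II -> : `I_n #= `I_(p ^ k).
  by rewrite -(card_eql Ln).
by rewrite pnatX pnat_id.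
Qed.

Lemma open_normal_index (L : set F) : open_normal L ->
  exists k, lcosets L #= `I_(p ^ k).
Proof. by move=> [nL oL]; have [_ _ _ /(_ _ nL oL)] := freeF.1. Qed.

Lemma open_normal_central (L : set F) n : open_normal L ->
  (forall i, L [~ n, x i]) -> forall g, L [~ n, g].
Proof.
move=> oL; have [k /(open_normal_quotient oL)] := open_normal_index oL.
move=> [gT [f [fM fS LE _ pG]]]; have oK := oL.2; rewrite LE in oK *.
move=> /= nx g; rewrite morph_comm //.
have sC : [set: gT]%SET \subset 'C[f n].
  rewrite -(free_pro_p_quotient_gen freeF pG fM fS oK) gen_subG.
  apply/fintype.subsetP=> _ /imsetP[i _ ->].
  by rewrite cent1C; apply/cent1P/commgP; rewrite -morph_comm // nx.
by apply/eqP/commgP/cent1P; rewrite cent1C (fintype.subsetP sC) ?inE.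
Qed.

Lemma open_normal_full (L : set F) : open_normal L ->
  (forall i, L (x i)) -> forall g, L g.
Proof.
move=> oL; have [k /(open_normal_quotient oL)] := open_normal_index oL.
move=> [gT [f [fM fS LE _ pG]]]; have oK := oL.2; rewrite LE in oK *.
move=> /= fx g; have : [set: gT]%SET \subset [1 gT]%SET.
  rewrite -(free_pro_p_quotient_gen freeF pG fM fS oK) gen_subG.
  by apply/fintype.subsetP=> _ /imsetP[i _ ->]; rewrite inE fx.
by move/fintype.subsetP/(_ (f g)); rewrite !inE => /(_ isT)/eqP.
Qed.

(** Minimality among open normal subgroups takes the place of a normal closure: the list determines
    [M], which is what the count needs. *)
Definition normal_gens (M : set F) (S : seq F) :=
  [/\ open_normal M, {in S, forall s, M s} &
    forall L, open_normal L -> {in S, forall s, L s} -> M `<=` L].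

Lemma normal_gens_inj M N S : normal_gens M S -> normal_gens N S -> M = N.
Proof.
move=> [oM SM Mmin] [oN SN Nmin].
by apply/seteqP; split; [exact: Mmin | exact: Nmin].
Qed.

(* c = (j, a): normal generators of a subgroup of index p in the subgroup
   normally generated by S. *)
Definition succ_gens r (S : seq F) (c : 'I_r * {ffun 'I_r -> 'I_p}) : seq F :=
  [seq nth 1 S i * nth 1 S c.1 ^- (c.2 i) | i : 'I_r <- enum 'I_r] ++
  nth 1 S c.1 ^+ p :: [seq [~ nth 1 S c.1, x l] | l : 'I_d <- enum 'I_d].

Lemma open_normal_succ (M : set F) k : open_normal M ->
  lcosets M #= `I_(p ^ k.+1) ->
  exists N, [/\ open_normal N, lcosets N #= `I_(p ^ k) &
    forall r S, size S = r -> normal_gens N S ->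
      exists c : 'I_r * {ffun 'I_r -> 'I_p}, normal_gens M (succ_gens S c)].
Proof.
move=> oM /(open_normal_quotient oM) [gT [f [fM fS ME cT pG]]].
have oK := oM.2; rewrite ME in oK.
have ntG : [set: gT]%SET != [1 gT]%SET.
  by rewrite -cardG_gt1 cardsT cT -{1}(expn0 p) ltn_exp2l ?prime_gt1.
have [z zZ oz] : {z | z \in 'Z([set: gT]%SET) & #[z] = p}.
  apply: Cauchy => //; have : 'Z([set: gT]%SET) != 1.
    by apply: contraNneq ntG => /(trivg_center_pgroup pG) ->.
  have pZ : p.-group 'Z([set: gT]%SET) by exact: pgroupS (center_sub _) pG.
  by move=> /(pgroup_pdiv pZ)[].
have zC g : commute z g.
  by move/centerP: zZ => [_]; apply; rewrite inE.
have nZ : [set: gT]%SET \subset 'N(<[z]>).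
  rewrite cents_norm // centsC cycle_subG; apply/centP => g _; exact: zC.
(* N is the preimage of a central subgroup of order p. *)
exists (f @^-1` [set` <[z]> ]); split.
- exact: open_normal_preim.
- suff -> : (p ^ k = #|[set: gT]%SET : <[z]>|)%N by exact: lcosets_preim.
  have := Lagrange (finset.subsetT <[z]>).
  rewrite -/(#[z]) oz cardsT cT expnS => /eqP.
  by rewrite eqn_pmul2l ?prime_gt0 // => /eqP.
move=> r S szS [oN SN Nmin].
(* Otherwise N would lie in [M], while [z], the image of an element of N, is not 1. *)
have [j Mj] : exists j : 'I_r, ~ M (nth 1 S j).
  apply: contrapT => /forallNP MS.
  have : f @^-1` [set` <[z]> ] `<=` M.
    apply: Nmin => // s sS; have sr : (index s S < r)%N by rewrite -szS index_mem.
    by have /contrapT := MS (Ordinal sr); rewrite /= nth_index.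
  have [y _ yz] := fS z I.
  rewrite ME => /(_ y); rewrite /= yz cycle_id => /(_ isT) z1.
  by move: oz (prime_gt1 pr_p); rewrite z1 order1 => <-.
set b := nth 1 S j in Mj *.
have Sz i : f (nth 1 S i) \in <[z]>.
  have [iS|iS] := ltnP i (size S); first by apply: SN; exact: mem_nth.
  by rewrite nth_default // morph_one.
(* Having order p, the image of [b] generates <z>; the exponents [a i] express the other images as
   its powers. *)
have bz : <[f b]> = <[z]>.
  have fb1 : #[f b] != 1%N.
    by rewrite order_eq1; apply/eqP => fb1; apply: Mj; rewrite ME.
  have := order_dvdG (Sz j); rewrite -/(#[z]) oz => /(prime_nt_dvdP pr_p fb1) ob.
  by apply/eqP; rewrite eqEcard cycle_subG Sz -/(#[z]) -/(#[f b]) oz ob leqnn.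
have ob : #[f b] = p by rewrite /order bz.
have aP i : exists a : 'I_p, f (nth 1 S i) = f b ^+ a.
  have := Sz i; rewrite -bz => /cyclePmin[a]; rewrite ob => ap ->.
  by exists (Ordinal ap).
have [a aE] := choice (fun i : 'I_r => aP i).
exists (j, [ffun i => a i]).
have SM : {in succ_gens S (j, [ffun i => a i]), forall s, M s}.
  move=> s; rewrite mem_cat inE ME => /or3P[/mapP[i _ ->]|/eqP ->|/mapP[l _ ->]] /=.
  - by rewrite ffunE fM morph_inv // morph_exp // aE mulgV.
  - by rewrite morph_exp // -ob expg_order.
  - rewrite morph_comm //; apply/eqP/commgP.
    have : f b \in <[z]> by exact: Sz.
    by move=> /cycleP[m ->]; apply: commute_sym; apply: commuteX; exact/commute_sym.
split=> // L oL SL.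
(* Working modulo the intersection gives congruences modulo [L] and [M] at once. There [b] is
   central, and N maps into the cyclic group that [b] generates. *)
suff : M `<=` L `&` M by move=> h y /h[].
have oKK := open_normalI oL oM.
have SKK : {in succ_gens S (j, [ffun i => a i]), forall s, (L `&` M) s}.
  by move=> s sS; split; [exact: SL | exact: SM].
have bC g : (L `&` M) [~ b, g].
  apply: open_normal_central => // i; apply: SKK.
  rewrite mem_cat inE; apply/or3P/Or33/mapP.
  by exists i; rewrite ?mem_enum.
have [m /(open_normal_quotient oKK)] := open_normal_index oKK.
move=> [gT' [f' [f'M f'S KE _ _]]].
have oK' := oKK.2; rewrite KE in oK'.
have nb : [set: gT']%SET \subset 'N(<[f' b]>).
  rewrite cents_norm // centsC cycle_subG; apply/centP => y _.
  have [g _ <-] := f'S y I; apply/commgP/eqP.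
  by rewrite -morph_comm //; have := bC g; rewrite KE.
have NK : f @^-1` [set` <[z]> ] `<=` f' @^-1` [set` <[f' b]> ].
  apply: Nmin; first exact: open_normal_preim.
  move=> s sS; have sr : (index s S < r)%N by rewrite -szS index_mem.
  have : (L `&` M) (s * b ^- a (Ordinal sr)).
    apply: SKK; rewrite mem_cat; apply/orP; left; apply/mapP.
    by exists (Ordinal sr); rewrite ?mem_enum //= ffunE nth_index.
  rewrite KE /= f'M morph_inv // morph_exp // => /eqP.
  by rewrite -eq_mulgV1 => /eqP ->; exact: mem_cycle.
(* An element y of [M] is b^e modulo the intersection. So b^e lies in [M], hence p divides e, and
   b^p lies in the intersection. *)
move=> y My; have /NK : (f @^-1` [set` <[z]> ]) y.
  by move: My; rewrite ME /= => ->; exact: group1.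
move=> /cycleP[e f'y].
have bp : f' b ^+ p = 1.
  have : (L `&` M) (b ^+ p) by apply: SKK; rewrite mem_cat inE eqxx orbT.
  by rewrite KE /= morph_exp.
have [_ Myb] : (L `&` M) (y * b ^- e).
  by rewrite KE /= f'M morph_inv // morph_exp // f'y mulgV.
have /dvdnP[q eE] : (p %| e)%N.
  move: My Myb; rewrite ME /= fM morph_inv // morph_exp // => -> /eqP.
  by rewrite mul1g invg_eq1 -order_dvdn ob.
by rewrite KE /= f'y eE mulnC expgM bp expg1n.
Qed.

End Enumeration.

(** * Counting open normal subgroups by lists of normal generators *)

Section Counting.
Variables (p d : nat) (F : topologicalGroupType) (x : 'I_d -> F).
Hypotheses (pr_p : prime p) (freeF : free_pro_p p x).

(** F itself has [d] generators; each step keeps as many entries as before and adds one p-th power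
    and [d] commutators. *)
Definition gens_size k := (d + k * d.+1)%N.

Fixpoint gens_list k : seq (seq F) :=
  if k is k'.+1 then
    [seq succ_gens x s c | s <- gens_list k',
       c <- enum {: 'I_(gens_size k') * {ffun 'I_(gens_size k') -> 'I_p}}]
  else [:: [seq x i | i <- enum 'I_d]].

Lemma size_gens_list k S : S \in gens_list k -> size S = gens_size k.
Proof.
elim: k S => [|k IHk] S.
  by rewrite inE => /eqP ->; rewrite size_map size_enum_ord /gens_size addn0.
case/allpairsP=> -[S' c] [_ _ ->].
rewrite /succ_gens size_cat /= !size_map -!enumT !size_enum_ord /gens_size.
by rewrite mulSn addnCA addnC.
Qed.

Lemma gens_list_complete k (M : set F) : open_normal M ->
  lcosets M #= `I_(p ^ k) -> exists2 s, s \in gens_list k & normal_gens M s.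
Proof.
elim: k M => [|k IHk] M oM.
  move=> /(open_normal_quotient pr_p freeF oM)[gT [f [_ _ ME cT _]]].
  have M1 g : M g.
    have /fintype_le1P eqT : (#|gT| <= 1)%N by rewrite cT.
    by rewrite ME /=; exact: eqT.
  exists [seq x i | i <- enum 'I_d]; first by rewrite inE.
  split=> // L oL Lx g _; apply: (open_normal_full pr_p freeF oL) => i.
  by apply: Lx; rewrite map_f ?mem_enum.
move=> /(open_normal_succ pr_p freeF oM)[N [oN Nk Nstep]].
have [s Sk NS] := IHk N oN Nk.
have [c Mc] := Nstep _ _ (size_gens_list Sk) NS.
by exists (succ_gens x s c) => //; apply: allpairs_f => //; rewrite mem_enum.
Qed.

(** Passing from k to k+1 multiplies the size by r p^r <= p^(2r), where r = [gens_size k], and 2r <=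
    2(d+1)((k+1)^2 - k^2). *)
Lemma size_gens_list_le k :
  (size (gens_list k) <= p ^ (2 * d.+1 * k ^ 2))%N.
Proof.
elim: k => [|k IHk]; first by rewrite expn_gt0 prime_gt0.
rewrite size_allpairs -cardT card_prod card_ffun !card_ord.
have p1 := prime_gt1 pr_p.
have ck := ltnW (ltn_expl (gens_size k) p1).
apply: leq_trans (leq_mul IHk (leq_mul ck (leqnn _))) _.
rewrite -!expnD leq_exp2l // /gens_size.
nia.
Qed.

Definition gens_upto K := flatten [seq gens_list k | k <- iota 0 K.+1].

Lemma size_gens_upto K : (size (gens_upto K) <= p ^ ((2 * d + 3) * K ^ 2))%N.
Proof.
have p1 := prime_gt1 pr_p.
have : (size (gens_upto K) <= K.+1 * p ^ (2 * d.+1 * K ^ 2))%N.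
  rewrite size_flatten /shape -map_comp sumnE big_map.
  rewrite -[iota _ _]/(index_iota 0 K.+1) big_mkord.
  rewrite -[X in (_ <= X * _)%N]card_ord -sum_nat_const; apply: leq_sum => k _.
  apply: leq_trans (size_gens_list_le k) _; rewrite leq_exp2l // leq_mul //.
  by rewrite leq_exp2r // -ltnS.
(* The number K+1 of levels is at most p^K, and K <= K^2; this raises the coefficient from 2d+2 to
   2d+3. *)
move=> /leq_trans; apply; case: K => [|K]; first by rewrite !muln0.
apply: leq_trans (leq_mul (ltn_expl K.+1 p1) (leqnn _)) _.
rewrite -expnD leq_exp2l //; nia.
Qed.

Lemma card_open_normal_le n : (0 < n)%N ->
  open_normal_subgroups F n #<= `I_(p ^ ((2 * d + 3) * trunc_log p n ^ 2)).
Proof.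
move=> n0; set K := trunc_log p n.
(* Stated for every set N, so that choice yields a total function; sets that are not counted get the
   empty list. *)
have gen N : exists s, open_normal_subgroups F n N ->
    s \in gens_upto K /\ normal_gens N s.
  have [[nN oN Nn]|nA] := pselect (open_normal_subgroups F n N); last first.
    by exists [::].
  have oNN : open_normal N by [].
  have [k Nk] := open_normal_index freeF oNN.
  have [s Sk NS] := gens_list_complete oNN Nk; exists s => _; split=> //.
  apply/flattenP; exists (gens_list k) => //; apply: map_f.
  rewrite mem_iota add0n /= ltnS; apply: trunc_log_max; first exact: prime_gt1.
  by rewrite -card_le_II -(card_le_eql Nk).
have [g gP] := choice gen.
apply: (@card_le_trans _ _ _ `I_(size (gens_upto K))); last first.
  by rewrite card_le_II; exact: size_gens_upto.
apply: (@card_le_inj_on _ _ _ _ (fun N => index (g N) (gens_upto K))).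
  move=> N /gP[gN _]; change (index (g N) (gens_upto K) < size (gens_upto K))%N.
  by rewrite index_mem.
move=> M N /gP[gM Mg] /gP[gN Ng] eqi.
have e : g M = g N by rewrite -(nth_index [::] gM) eqi nth_index.
by rewrite e in Mg; exact: normal_gens_inj Mg Ng.
Qed.

End Counting.

(** * The shift Heisenberg group *)

Section ShiftHeisenberg.
Variables (p : nat) (A : finZmodType) (K : finType) (kap : K -> A).

Local Notation V := {ffun A -> 'F_p}.
Local Notation Z := {ffun K -> 'F_p}.

Definition shift (s : A) (v : V) : V := [ffun i => v (i - s)%R].
Definition correl (v w : V) : Z := [ffun k => \sum_i v (i + kap k)%R * w i]%R.

Lemma shift0 v : shift 0%R v = v.
Proof. by apply/ffunP=> i; rewrite ffunE subr0. Qed.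

Lemma shiftD s v w : shift s (v + w)%R = (shift s v + shift s w)%R.
Proof. by apply/ffunP=> i; rewrite !ffunE. Qed.

Lemma shift_shift s t v : shift s (shift t v) = shift (s + t)%R v.
Proof. by apply/ffunP=> i; rewrite !ffunE opprD addrA. Qed.

Lemma correlDl v w u : correl (v + w)%R u = (correl v u + correl w u)%R.
Proof.
apply/ffunP=> k; rewrite !ffunE -big_split; apply: eq_bigr => i _ /=.
by rewrite !ffunE mulrDl.
Qed.

Lemma correlDr v w u : correl u (v + w)%R = (correl u v + correl u w)%R.
Proof.
apply/ffunP=> k; rewrite !ffunE -big_split; apply: eq_bigr => i _ /=.
by rewrite !ffunE mulrDr.
Qed.

Lemma correl0l v : correl 0%R v = 0%R.
Proof. by apply: (addIr (correl 0%R v)); rewrite -correlDl !add0r. Qed.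

Lemma correl0r v : correl v 0%R = 0%R.
Proof. by apply: (addIr (correl v 0%R)); rewrite -correlDr !add0r. Qed.

(** Reindexing by i -> i + s. This invariance lets [A] act by automorphisms on the extension, and
    associativity of [heis_mul] rests on it. *)
Lemma correl_shift s v w : correl (shift s v) (shift s w) = correl v w.
Proof.
apply/ffunP=> k; rewrite !ffunE (reindex_inj (addIr s)) /=.
by apply: eq_bigr => i _; rewrite !ffunE addrK addrAC addrK.
Qed.

(* The semidirect product by A of a class 2 group: an extension of V by the
   central subgroup Z with the correlation as cocycle. *)
Definition heis_of of (K -> A) : Type := (A * V * Z)%type.
Local Notation heis := (heis_of kap).
HB.instance Definition _ f := Finite.copy (heis_of f) (A * V * Z)%type.

Definition heis_mul (x y : heis) : heis :=
  (x.1.1 + y.1.1, x.1.2 + shift x.1.1 y.1.2,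
   x.2 + y.2 + correl x.1.2 (shift x.1.1 y.1.2))%R.
Definition heis_one : heis := (0, 0, 0)%R.
Definition heis_inv (x : heis) : heis :=
  let w := shift (- x.1.1)%R x.1.2 in
  (- x.1.1, - w, - x.2 - correl (- w) w)%R.

Lemma heis_mulA : associative heis_mul.
Proof.
move=> [[s v] z] [[s' v'] z'] [[s'' v''] z'']; rewrite /heis_mul /=.
rewrite -(correl_shift s v') !shift_shift !shiftD !shift_shift !correlDl !correlDr.
rewrite !addrA; congr (_, _, _)%R.
rewrite [RHS]addrAC; congr (_ + _)%R; rewrite addrAC; congr (_ + _)%R.
by rewrite addrAC.
Qed.

Lemma heis_mul1 : left_id heis_one heis_mul.
Proof. by move=> [[s v] z]; rewrite /heis_mul /= shift0 correl0l !add0r addr0. Qed.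

Lemma heis_mulV : left_inverse heis_one heis_inv heis_mul.
Proof.
move=> [[s v] z]; rewrite /heis_mul /= !addNr; congr (_, _, _).
by rewrite addrAC addrNK addNr.
Qed.

HB.instance Definition _ := Finite_isGroup.Build heis
  heis_mulA heis_mul1 heis_mulV.

Lemma heis_mulE (x y : heis) : x * y =
  (x.1.1 + y.1.1, x.1.2 + shift x.1.1 y.1.2,
   x.2 + y.2 + correl x.1.2 (shift x.1.1 y.1.2))%R.
Proof. by []. Qed.

Definition heisT (s : A) : heis := (s, 0, 0)%R.
Definition heisV (v : V) : heis := (0, v, 0)%R.
Definition heisZ (z : Z) : heis := (0, 0, z)%R.

Lemma heisTD s t : heisT (s + t)%R = heisT s * heisT t.
Proof.
rewrite heis_mulE /=; congr (_, _, _); last by rewrite correl0l !addr0.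
by rewrite add0r; apply/ffunP=> i; rewrite !ffunE.
Qed.

Lemma heisZD y z : heisZ (y + z)%R = heisZ y * heisZ z.
Proof. by rewrite heis_mulE /= shift0 correl0l !addr0. Qed.

Lemma heisVT s v : heisT s * heisV v * (heisT s)^-1 = heisV (shift s v).
Proof.
apply: (mulIg (heisT s)); rewrite mulgVK !heis_mulE /= !shift0 !add0r correl0l !addr0.
by rewrite correl0r.
Qed.

(** On this layer xy and yx have the same [V] coordinate, and their [Z] coordinates differ only
    through the cocycle. Multiplying by yx compares them. *)
Lemma heis_comm_layer (x y : heis) : x.1.1 = 0%R -> y.1.1 = 0%R ->
  [~ x, y] = heisZ (correl x.1.2 y.1.2 - correl y.1.2 x.1.2)%R.
Proof.
case: x y => [[s v] z] [[s' v'] z'] /= -> ->.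
apply: (mulgI (((0, v', z')%R : heis) * ((0, v, z)%R : heis))).
rewrite /commg /conjg !mulgA mulgK mulgV mul1g.
rewrite !heis_mulE /= !addr0 !shift0 correl0r !addr0; congr (_, _, _)%R.
  by rewrite addrC.
by rewrite [(z' + z)%R]addrC -[RHS]addrA [(correl v' v + _)%R]addrC subrK.
Qed.

Lemma heisZ_central z (x : heis) : heisZ z * x = x * heisZ z.
Proof.
case: x => [[s v] y]; rewrite !heis_mulE /=.
have -> : shift s 0%R = 0%R :> V by apply/ffunP=> i; rewrite !ffunE.
by rewrite shift0 correl0l correl0r !addr0 !add0r addrC.
Qed.

Definition heis_top (x : heis) : A := x.1.1.

Lemma heis_topM : {morph heis_top : x y / x * y >-> (x + y)%R}.
Proof. by []. Qed.

Definition unit_ffun (I : finType) (i : I) : {ffun I -> 'F_p} :=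
  [ffun j => (j == i)%:R%R].

Lemma shift_unit s t : shift s (unit_ffun t) = unit_ffun (t + s)%R.
Proof. by apply/ffunP=> i; rewrite !ffunE subr_eq. Qed.

Lemma correl_unit s t :
  correl (unit_ffun s) (unit_ffun t) = [ffun k => (t + kap k == s)%R%:R%R].
Proof.
apply/ffunP=> k; rewrite !ffunE (bigD1 t) //= big1 => [|i /negPf it].
  by rewrite !ffunE eqxx mulr1 addr0.
by rewrite !ffunE it mulr0.
Qed.

(** At coordinate l the first correlation detects kap l = kap k, and the reversed one detects kap k
    + kap l = 0, which is excluded. *)
Lemma heis_comm_unit k : injective kap -> (forall l, kap k + kap l != 0)%R ->
  [~ heisV (unit_ffun (kap k)), heisV (unit_ffun 0%R)] = heisZ (unit_ffun k).
Proof.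
move=> kI kk; rewrite heis_comm_layer //=; congr heisZ.
apply/ffunP=> l; rewrite !correl_unit !ffunE add0r (inj_eq kI).
by rewrite (negPf (kk l)) subr0.
Qed.

Lemma card_heis : prime p ->
  #|{: heis}| = (#|A| * p ^ #|A| * p ^ #|K|)%N.
Proof. by move=> pr_p; rewrite !card_prod !card_ffun card_Fp. Qed.

End ShiftHeisenberg.

(** * Transfer to quotients *)

Lemma lcosets_preim_le (E E' : groupType) (f : E -> E') (W : set E') :
  {morph f : a b / a * b} -> is_subgroup W -> lcosets (f @^-1` W) #<= lcosets W.
Proof.
move=> fM sW; apply: (card_le_trans (subset_card_le _) (card_image_le
  (fun C : set E' => f @^-1` C) _)).
move=> _ [a _ <-]; exists [set f a * y | y in W]; first by exists (f a).
rewrite !lcoset_setE //; last exact: preim_subgroup.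
by apply/seteqP; split=> b /=; rewrite fM morph_inv.
Qed.

Lemma card_lcosets_le (gT : finGroupType) (W : set gT) :
  lcosets W #<= `I_#|gT|.
Proof.
apply: card_le_trans (card_image_le _ _) _.
have /card_eqPle[h _] := card_finset [set: gT]%SET.
rewrite cardsT in h; apply: card_le_trans h; apply: subset_card_le => a _ /=.
by rewrite inE.
Qed.

Section Quotient.
Variables (F : topologicalGroupType) (N : normal_subgroup F).

Lemma quot_piM : {morph @quot_pi F N : a b / a * b}.
Proof. by move=> a b; rewrite -quot_mul_pi. Qed.

(** Taking preimages under the projection is injective, as the projection is onto, and does not
    raise the index. *)
Lemma open_normal_subgroups_quotient_le n :
  open_normal_subgroups (quotient_group N) n #<= open_normal_subgroups F n.
Proof.
apply: (@card_le_inj_on _ _ _ _ (fun M => @quot_pi F N @^-1` M)).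
  move=> M [nM oM Mn]; split.
  - by apply: preim_normal => //; exact: quot_piM.
  - by apply: open_comp => // a _; exact: quot_pi_continuous.
  - by apply: card_le_trans Mn; apply: lcosets_preim_le nM.1; exact: quot_piM.
move=> M M' _ _ /seteqP[MM' M'M]; apply/seteqP.
by split=> a; rewrite -(quot_reprK a) => h; [exact: MM' | exact: M'M].
Qed.

Lemma quotient_lift (gT : finGroupType) (f : F -> gT) :
  {morph f : a b / a * b} -> open (f @^-1` [set 1]) ->
  normal_set N `<=` f @^-1` [set 1] ->
  exists g : quotient_group N -> gT,
    [/\ {morph g : a b / a * b}, open (g @^-1` [set 1]) &
        forall a, g (quot_pi N a) = f a].
Proof.
move=> fM oK NK.
pose g (a : quotient_group N) := f (generic_quotient.repr (a : quot_top N)).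
have gE a : g (quot_pi N a) = f a.
  have /quot_piP/NK /= := quot_reprK (quot_pi N a).
  by rewrite fM morph_inv // => /eqP; rewrite -eq_mulVg1 => /eqP.
exists g; split=> //.
- move=> a b; rewrite -(quot_reprK a) -(quot_reprK b).
  by rewrite -[X in g X]quot_piM !gE.
- change (open (quot_pi N @^-1` (g @^-1` [set 1]))).
  by rewrite (_ : _ @^-1` _ = f @^-1` [set 1]) //; apply/seteqP;
    split=> a /=; rewrite gE.
Qed.

End Quotient.

(** * Homomorphisms to the shift Heisenberg group *)

Section ClosedCommutators.
Variables (F : topologicalGroupType) (A B : set F).

Lemma comm_sub_sub (C : set F) : is_subgroup C ->
  (forall a b, A a -> B b -> C [~ a, b]) -> comm_sub A B `<=` C.
Proof.
move=> sC abC; apply: smallest_sub => // _ [a [b [Aa Bb ->]]]; exact: abC.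
Qed.

Lemma closure_comm_sub_sub (C : set F) : is_subgroup C -> closed C ->
  (forall a b, A a -> B b -> C [~ a, b]) -> closure (comm_sub A B) `<=` C.
Proof.
move=> sC cC abC; rewrite [X in _ `<=` X]((closure_id C).1 cC).
by apply: closure_subset; exact: comm_sub_sub.
Qed.

End ClosedCommutators.

Section Heisenberg.
Variables (p : nat) (A : finZmodType) (K : finType) (kap : K -> A).
Local Notation heis := (heis_of p kap).
Variables (F : topologicalGroupType) (f : F -> heis).
Hypotheses (fM : {morph f : a b / a * b}) (oK : open (f @^-1` [set 1])).

Lemma heis_closed_preim (U : set heis) : closed (f @^-1` U).
Proof. by rewrite -openC preimage_setC; exact: open_preim. Qed.

Lemma heis_derived_lower3 : derived_lower3_set F `<=` f @^-1` [set 1].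
Proof.
(* [A] is abelian, so commutators have trivial [A] coordinate; preimages under [f] are closed, so
   the closure adds nothing. *)
have top : derived F `<=` f @^-1` [set h | h.1.1 = 0%R].
  apply: closure_comm_sub_sub; last 2 first.
  - exact: heis_closed_preim.
  - move=> a b _ _; rewrite /= morph_comm //.
    suff : heis_top [~ f a, f b] = 0%R by [].
    apply: (addrI (heis_top (f b * f a))); rewrite -heis_topM addr0.
    by rewrite /commg /conjg !mulgA mulgK mulgV mul1g !heis_topM addrC.
  - apply: preim_subgroup => //; split=> // h h' /= h0 h'0.
    suff : heis_top (h * h'^-1) = 0%R by [].
    apply: (addIr (heis_top h')); rewrite -heis_topM mulgVK add0r.
    by rewrite /heis_top h0 h'0.
have sZ : is_subgroup (range (@heisZ p _ _ kap)).
  split=> [|_ _ [y _ <-] [z _ <-]]; first by exists 0%R.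
  by exists (y - z)%R => //; apply: (mulIg (heisZ kap z)); rewrite mulgVK -heisZD subrK.
(* F' lands in the layer over 0, whose commutators lie in Z; as Z is central, the next commutator is
   trivial. *)
have central : comm_sub (derived F) (derived F) `<=` f @^-1` range (@heisZ p _ _ kap).
  apply: comm_sub_sub; first exact: preim_subgroup.
  move=> a b /top /= a0 /top /= b0; rewrite morph_comm //.
  by rewrite heis_comm_layer //; eexists.
apply: closure_comm_sub_sub.
- by apply: preim_subgroup => //; split=> [//|a b /= -> ->]; rewrite mulgV.
- exact: heis_closed_preim.
- move=> a b /central[z _ za] _; rewrite /= morph_comm // -za.
  by apply/eqP/commgP; exact: heisZ_central.
Qed.

Lemma heis_range (g0 : A) (a b : F) : (forall s, exists n, s = g0 *+ n)%R ->
  injective kap -> (forall k l, kap k + kap l != 0)%R ->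
  f a = heisT p kap g0 -> f b = heisV kap (unit_ffun p 0%R) ->
  forall z, exists c, f c = heisZ kap z.
Proof.
move=> gen kI kk fa fb.
have T s : exists c, f c = heisT p kap s.
  have [n ->] := gen s; exists (a ^+ n); rewrite morph_exp // fa.
  elim: n => [|n IHn]; first by rewrite expg0 mulr0n.
  by rewrite expgS mulrS IHn -heisTD.
have U k : exists c, f c = heisZ kap (unit_ffun p k).
  (* Conjugation by a preimage of the translation by [kap k] moves the indicator of 0 to that of
     [kap k]. *)
  have [c fc] := T (kap k); exists [~ c * b * c^-1, b].
  rewrite morph_comm // !fM morph_inv // fb fc heisVT shift_unit add0r.
  exact: heis_comm_unit.
(* Expansion in the standard basis, with coefficients read as natural numbers so that they become
   exponents. *)
move=> z; have -> : z = (\sum_k unit_ffun p k *+ z k)%R.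
  apply/ffunP=> k; rewrite sum_ffunE (bigD1 k) //= big1 => [|i /negPf ik].
    by rewrite ffunMnE ffunE eqxx natr_Zp addr0.
  by rewrite ffunMnE ffunE eq_sym ik mul0rn.
apply: (big_ind (fun y => exists c, f c = heisZ kap y)).
- by exists 1; rewrite morph_one.
- by move=> y y' [c fc] [c' fc']; exists (c * c'); rewrite fM fc fc' heisZD.
- move=> k _; have [c fc] := U k; exists (c ^+ z k); rewrite morph_exp // fc.
  elim: (nat_of_ord _) => [|n IHn]; first by rewrite expg0 mulr0n.
  by rewrite expgS mulrS IHn -heisZD.
Qed.

End Heisenberg.

(** * Lower bound *)

Section GraphSubgroups.
Variables (p : nat) (A : finZmodType) (I : finType) (kap : I + I -> A).
Local Notation heis := (heis_of p kap).

(** The graph of the linear map F_p^I -> F_p^I with matrix [T]. Distinct matrices have distinct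
    graphs, which yields p^(|I|^2) subspaces. *)
Definition graph_vectors (T : {ffun I * I -> 'F_p}) : set {ffun I + I -> 'F_p} :=
  [set z | forall j, z (inr j) = \sum_i T (i, j) * z (inl i)]%R.

Definition graph_subgroup T : set heis := heisZ kap @` graph_vectors T.

Lemma graph_subgroup_normal T : is_normal_subgroup (graph_subgroup T).
Proof.
split; last first.
  move=> _ y [z Tz <-]; exists z => //.
  by rewrite /conjg heisZ_central mulKg.
split=> [|_ _ [y Ty <-] [z Tz <-]].
  by exists 0%R => // j; rewrite ffunE big1 // => i _; rewrite ffunE mulr0.
exists (y - z)%R.
  move=> j; rewrite !ffunE Ty Tz -sumrB; apply: eq_bigr => i _.
  by rewrite !ffunE mulrBr.
by apply: (mulIg (heisZ kap z)); rewrite mulgVK -heisZD subrK.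
Qed.

Lemma graph_vectors_inj T T' : graph_vectors T `<=` graph_vectors T' -> T = T'.
Proof.
move=> TT'; apply/ffunP=> -[i j].
(* The point of the graph of [T] above the i-th basis vector. *)
pose z : {ffun I + I -> 'F_p} := [ffun k => match k with
  | inl i' => (i' == i)%:R%R | inr j' => T (i, j') end].
have zE T1 l : (\sum_i' T1 (i', l) * z (inl i'))%R = T1 (i, l).
  rewrite (bigD1 i) //= big1 => [|i' /negPf ii'].
    by rewrite ffunE eqxx mulr1 addr0.
  by rewrite ffunE ii' mulr0.
have /TT'/(_ j) : graph_vectors T z by move=> l; rewrite zE ffunE.
by rewrite zE ffunE.
Qed.

End GraphSubgroups.

Section LowerBound.
Variables (p d : nat) (F : topologicalGroupType) (x : 'I_d -> F).
Hypotheses (pr_p : prime p) (d_ge2 : (2 <= d)%N) (freeF : free_pro_p p x).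

Lemma card_open_normal_ge (A : finZmodType) (I : finType) (kap : I + I -> A)
    (g0 : A) :
  p.-nat #|A| -> (forall s, exists n, s = g0 *+ n)%R ->
  injective kap -> (forall k l, kap k + kap l != 0)%R ->
  `I_(p ^ (#|I| * #|I|)) #<=
  open_normal_subgroups (quotient_group (derived_lower3 F))
    (#|A| * p ^ #|A| * p ^ (#|I| + #|I|)).
Proof.
move=> pA gen kI kk.
have pH : p.-group [set: heis_of p kap]%SET.
  rewrite /pgroup cardsT card_heis // !pnatM pA !pnatX pnat_id //= !orbT.
pose y (i : 'I_d) : heis_of p kap :=
  if val i == 0%N then heisT p kap g0 else heisV kap (unit_ffun p 0%R).
have [f [[fc fM fx] _]] := freeF.2 (discrete_group _) y (pro_p_discrete pH).
have oK : open (f @^-1` [set 1]).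
  by apply: open_comp; [move=> a _; exact: fc | exact: discrete_group_open].
have fZ : forall z, exists c, f c = heisZ kap z.
  apply: (heis_range fM gen kI kk (a := x (Ordinal (ltnW d_ge2)))
    (b := x (Ordinal d_ge2))); by rewrite fx.
have [g [gM oKg gE]] := quotient_lift (N := derived_lower3 F) fM oK
  (heis_derived_lower3 fM oK).
have -> : (#|A| * p ^ #|A| * p ^ (#|I| + #|I|) = #|{: heis_of p kap}|)%N.
  by rewrite card_heis // card_sum.
have := card_finset [set: {ffun I * I -> 'F_p}]%SET.
rewrite cardsT card_ffun card_prod card_Fp // => /card_esym cT.
rewrite (card_le_eql cT).
pose W (T : {ffun I * I -> 'F_p}) : set (quotient_group (derived_lower3 F)) :=
  g @^-1` graph_subgroup T.
apply: (@card_le_inj_on _ _ _ _ W).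
  move=> T _; split.
  - by apply: preim_normal => //; exact: graph_subgroup_normal.
  - exact: open_preim.
  - apply: card_le_trans (card_lcosets_le _).
    by apply: lcosets_preim_le => //; exact: (graph_subgroup_normal _ _).1.
move=> T T' _ _ /seteqP[TT' _]; apply: graph_vectors_inj => z Tz.
(* The image of [f] contains Z, so a graph subgroup is determined by its preimage. *)
have [c fcz] := fZ z.
have /TT'[z' T'z'] : W T (quot_pi _ c).
  by rewrite /W /= gE fcz; exists z.
by rewrite gE fcz => -[<-].
Qed.

(** Take A = Z/q with q = p^(m+3), and the shifts 1, ..., 2p^m. Since q >= 8p^m, a sum of two shifts
    lies strictly between 0 and q. *)
Lemma card_open_normal_family m :
  `I_(p ^ (p ^ m * p ^ m)) #<=
  open_normal_subgroups (quotient_group (derived_lower3 F))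
    (p ^ (m + 3 + p ^ (m + 3) + 2 * p ^ m)).
Proof.
have p1 := prime_gt1 pr_p.
set q := (p ^ (m + 3))%N; set P := (p ^ m)%N.
have P0 : (0 < P)%N by rewrite expn_gt0 prime_gt0.
have qP : (8 * P <= q)%N.
  by rewrite /q expnD mulnC leq_mul2l (@leq_exp2r 2 p 3) // p1 orbT.
(* The successor form gives the ordinal type its additive group structure Z/q. *)
have q0 : (q.-1.+1 = q)%N by rewrite prednK //; lia.
pose kap (k : 'I_P + 'I_P) : 'I_q.-1.+1 := match k with
  | inl i => inZp i.+1 | inr j => inZp (P + j.+1) end.
pose kn (k : 'I_P + 'I_P) : nat := match k with
  | inl i => i.+1 | inr j => P + j.+1 end.
have kapE k : kap k = inZp (kn k) by case: k.
have knP k : (0 < kn k <= 2 * P)%N.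
  by case: k => i /=; have := ltn_ord i; lia.
have kapV k : kap k = kn k :> nat.
  by rewrite kapE /= modn_small //; have := knP k; rewrite q0; lia.
have kapI : injective kap.
  move=> k l /(congr1 val) /=; rewrite !kapV.
  by case: k l => i [j|j] /= ij; [congr inl | | | congr inr];
    try apply/val_inj; have := ltn_ord i; have := ltn_ord j => /=; lia.
have kap0 k l : (kap k + kap l != 0)%R.
  apply/eqP => /(congr1 val) /=; rewrite !kapV modn_small ?q0;
    by have := knP k; have := knP l; lia.
have gen (s : 'I_q.-1.+1) : exists n, (s = inZp 1 *+ n)%R.
  exists s; rewrite Zp_mulrn; apply/val_inj => /=.
  by rewrite modnMml mul1n modn_small.
have pA : p.-nat #|'I_q.-1.+1| by rewrite card_ord q0 pnatX pnat_id.
have := card_open_normal_ge pA gen kapI kap0.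
rewrite !card_ord q0 addnn -mul2n.
by rewrite {1}/q -!expnD.
Qed.

End LowerBound.

(** * Comparison of logarithms *)

Lemma ln_natX (R : realType) (p k : nat) : (0 < p)%N ->
  ln ((p ^ k)%N%:R : R) = (k%:R * ln p%:R)%R.
Proof. by move=> p0; rewrite natrX lnXn ?ltr0n // mulr_natl. Qed.

Lemma ln_nat_le (R : realType) (a b : nat) : (0 < b)%N -> (a <= b)%N ->
  (ln (a%:R : R) <= ln (b%:R : R))%R.
Proof.
move=> b0 ab; have [->|a0] := posnP a; first by rewrite ln0 // ln_ge0 // ler1n.
by rewrite ler_ln ?posrE ?ltr0n // ler_nat.
Qed.

(** The logarithm of n^(ln n) is (ln n)^2. For the upper bound, [trunc_log p n] is at most ln n / ln
    p. For the lower bound, n = p^E with E <= D p^m, so (ln n)^2 is at most a constant times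
    p^(2m). *)
Lemma of_type_pow_log (R : realType) (p C : nat) (f : nat -> nat) :
  prime p ->
  (forall n, (0 < n)%N -> (f n <= p ^ (C * trunc_log p n ^ 2))%N) ->
  (forall m, (p ^ (p ^ m * p ^ m) <=
    f (p ^ (m + 3 + p ^ (m + 3) + 2 * p ^ m)))%N) ->
  of_type (fun n => (f n)%:R : R)%R (fun n => n%:R `^ ln n%:R)%R.
Proof.
move=> pr_p fle fge; have p1 := prime_gt1 pr_p; have p0 := ltnW p1.
set L : R := ln p%:R; have L0 : (0 < L)%R by rewrite ln_gt0 // ltr1n.
(* In E = m + 3 + p^(m+3) + 2p^m the terms m and 3 are at most p^m and 3p^m, whence E <= (p^3 + 6)
   p^m. *)
pose D : nat := (p ^ 3 + 6)%N.
have D0 : (0 < D%:R :> R)%R by rewrite ltr0n /D; lia.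
(* [C.+1] keeps the first constant positive when C = 0; the factor 2 in the second leaves room for
   the strict inequality. *)
exists (C.+1%:R / L)%R, ((D%:R ^+ 2 * L *+ 2)^-1)%R; split.
- by rewrite divr_gt0 ?ltr0n.
- by rewrite invr_gt0 pmulrn_lgt0 // mulr_gt0 // exprn_gt0.
- move=> n n0; rewrite ln_powR.
  apply: le_trans (ln_nat_le _ _ (fle n n0)) _; first by rewrite expn_gt0 prime_gt0.
  rewrite ln_natX // -/L; set K := trunc_log p n.
  have KL : (K%:R * L <= ln n%:R)%R.
    by rewrite /L -ln_natX //; apply: ln_nat_le => //; exact: trunc_logP.
  have KL2 : ((K%:R * L) ^+ 2 <= ln n%:R * ln n%:R)%R.
    by rewrite expr2 ler_pM // mulr_ge0 // ltW.
  have -> : ((C * K ^ 2)%:R * L = C%:R / L * (K%:R * L) ^+ 2 :> R)%R.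
    by rewrite natrM natrX; field; rewrite gt_eqF.
  apply: le_trans (_ : C.+1%:R / L * (K%:R * L) ^+ 2 <= _)%R; last first.
    by rewrite ler_pM2l // divr_gt0 // ltr0n.
  by rewrite ler_wpM2r ?sqr_ge0 // ler_wpM2r ?invr_ge0 ?(ltW L0) // ler_nat.
- move=> m; set P := (p ^ m)%N.
  have mP : (m < P)%N := ltn_expl m p1.
  exists (p ^ (m + 3 + p ^ (m + 3) + 2 * P))%N; split.
    apply: leq_trans (ltnW mP) _; rewrite leq_exp2l //; lia.
  set E := (m + 3 + _ + _)%N.
  have ED : (E <= D * P)%N by rewrite /E /D expnD -/P; nia.
  apply: lt_le_trans (ln_nat_le _ _ (fge m)); last first.
    by apply: leq_trans (fge m); rewrite expn_gt0 prime_gt0.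
  rewrite ln_powR !ln_natX // -/L -/P.
  have P0 : (0 < P%:R :> R)%R by rewrite ltr0n; exact: leq_ltn_trans mP.
  have EDR : (E%:R <= D%:R * P%:R :> R)%R by rewrite -natrM ler_nat.
  have E2 : (E%:R * L * (E%:R * L) <= (D%:R * P%:R * L) ^+ 2)%R.
    by rewrite expr2 ler_pM ?mulr_ge0 ?ler_wpM2r // ltW.
  apply: le_lt_trans (_ : (D%:R ^+ 2 * L *+ 2)^-1 * (D%:R * P%:R * L) ^+ 2 < _)%R.
    by rewrite ler_wpM2l // invr_ge0 mulrn_wge0 // mulr_ge0 ?sqr_ge0 // ltW.
  have -> : ((D%:R ^+ 2 * L *+ 2)^-1 * (D%:R * P%:R * L) ^+ 2 =
             (P * P)%:R * L / 2 :> R)%R.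
    by rewrite natrM; field; rewrite ?gt_eqF.
  by rewrite gtr_pMr ?invf_lt1 ?ltr1n // natrM !mulr_gt0.
Qed.

Theorem proposition4 (R : realType) (p d : nat) (F : topologicalGroupType)
    (x : 'I_d -> F) :
  prime p -> (2 <= d)%N -> free_pro_p p x ->
  normal_subgroup_growth (quotient_group (derived_lower3 F))
    (fun n => (n%:R `^ ln n%:R)%R : R).
Proof.
move=> pr_p d_ge2 freeF; set G := quotient_group _.
have le n : (0 < n)%N -> open_normal_subgroups G n #<=
    `I_(p ^ ((2 * d + 3) * trunc_log p n ^ 2)).
  move=> n0; apply: card_le_trans (open_normal_subgroups_quotient_le _ _) _.
  exact: card_open_normal_le pr_p freeF _ n0.
have fin n : exists k, open_normal_subgroups G n #= `I_k.
  (* The bound holds for positive arguments only; taking it at n+1 covers n = 0 as well. *)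
  apply/finite_set_leP; exists (p ^ ((2 * d + 3) * trunc_log p n.+1 ^ 2))%N.
  apply: card_le_trans (le n.+1 isT); apply: subset_card_le => N [nN oN Nn].
  by split=> //; apply: card_le_trans Nn _; rewrite card_le_II.
have [f fE] := choice fin; exists f; split=> //.
apply: (@of_type_pow_log R p (2 * d + 3)%N f pr_p).
  by move=> n /le; rewrite (card_le_eql (fE n)) card_le_II.
move=> m; have := card_open_normal_family pr_p d_ge2 freeF m.
by rewrite (card_le_eqr (fE _)) card_le_II.
Qed.
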